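(* Let $P$ be a set of $n\geq 3$ points in convex position in the plane (with no three collinear). Then no intersecting family of triangles spanned by $P$ contains more than $F(n)$ triangles, where $F(n)=\binom{\lceil\frac{n+2}{2}\rceil}{3}+\binom{\lfloor\frac{n+2}{2}\rfloor}{3}$. On the other hand, there exists an intersecting family of triangles spanned by $P$ that has exactly $F(n)$ triangles.
   Context: A triangle is spanned by a point set $P$ if its three vertices belong to $P$. Two triangles are intersecting if their interiors intersect, and a family of triangles is intersecting if every two of its members are intersecting. *)

(* Defs.v *)
From HB Require Import structures.
From mathcomp Require Import all_boot all_order all_algebra finmap.
From mathcomp Require Import all_classical all_reals all_analysis.

Set Implicit Arguments.
Unset Strict Implicit.
Unset Printing Implicit Defensive.

Import Order.TTheory GRing.Theory Num.Theory.
Import numFieldNormedType.Exports.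

Local Open Scope classical_set_scope.
Local Open Scope ring_scope.

Definition conv_hull (R : numDomainType) (M : lmodType R) (A : set M) : set M :=
  smallest (@convex_set R M) A.

Definition convex_position (R : realType) (P : {fset 'rV[R]_2}) : Prop :=
  forall p, p \in P -> ~ conv_hull [set` (P `\ p)%fset] p.

Definition collinear (R : realType) (A : set 'rV[R]_2) : Prop :=
  exists a v : 'rV[R]_2,
    v != 0 /\ forall x, A x -> exists t : R, x = a + t *: v.

Definition no_three_collinear (R : realType) (P : {fset 'rV[R]_2}) : Prop :=
  forall T : {fset 'rV[R]_2},
    (T `<=` P)%fset -> #|` T|%fset = 3%N -> ~ collinear [set` T].

(* A triangle is encoded by the set of its three vertices; the corresponding
   region of the plane is [conv_hull [set` T]]. *)
Definition spanned_triangle (R : realType) (P T : {fset 'rV[R]_2}) : Prop :=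
  (T `<=` P)%fset /\ #|` T|%fset = 3%N.

Definition intersecting (R : realType) (S T : {fset 'rV[R]_2}) : Prop :=
  (conv_hull [set` S])° `&` (conv_hull [set` T])° !=set0.

Definition intersecting_family (R : realType)
    (F : {fset {fset 'rV[R]_2}}) : Prop :=
  forall S T, S \in F -> T \in F -> S != T -> intersecting S T.

Definition family_spanned_by (R : realType) (P : {fset 'rV[R]_2})
    (F : {fset {fset 'rV[R]_2}}) : Prop :=
  forall T, T \in F -> spanned_triangle P T.

(* [uphalf m] is the ceiling of m / 2. *)
Definition max_intersecting (n : nat) : nat :=
  ('C(uphalf (n + 2), 3) + 'C((n + 2)./2, 3))%N.

(* Main.v *)
(* Upper bound. Two triangles of the family cannot lie on opposite closed sides
   of a line through two points of P, so every pair of points can be oriented as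
   i -> j such that the closed left side of the line ij contains no triangle of
   the family. A triangle of the family then has no vertex dominating the two
   others, i.e. it is a cyclic triangle of this tournament. A tournament has
   C(n,3) - sum_v C(outdeg v, 2) cyclic triangles, and convexity of C(d,2)
   together with sum_v outdeg v = C(n,2) bounds this by F(n).

   Lower bound. Number P counterclockwise and take the cyclic triangles of the
   balanced circular tournament. Two distinct ones always have edges that cross
   properly, and their interiors meet near the crossing point. *)

Require Import Defs.
From mathcomp Require Import all_boot all_order all_algebra finmap boolp.
From mathcomp Require Import zify ring lra.
Set Implicit Arguments.
Unset Strict Implicit.
Unset Printing Implicit Defensive.

(** * Cyclic triangles in tournaments *)

Section Tournament.
Variables (V : finType) (t : rel V).
Hypothesis t_irr : forall x, ~~ t x x.
Hypothesis t_total : forall x y, x != y -> t x y = ~~ t y x.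

Definition source (A : {set V}) (v : V) := (v \in A) && (A :\ v \subset t v).

(* In a tournament, the triples without a source are the 3-cycles. *)
Definition cyclic_triples : {set {set V}} :=
  [set A : {set V} | (#|A| == 3) && ~~ [exists v, source A v]].

(** Two distinct sources would have to dominate each other. *)
Lemma source_uniq A v w : source A v -> source A w -> v = w.
Proof.
move=> /andP[vA /subsetP sv] /andP[wA /subsetP sw]; apply/eqP/negPn/negP => nvw.
have := sv w; rewrite !inE wA eq_sym nvw => /(_ isT); rewrite unfold_in t_total//.
have := sw v; rewrite !inE vA nvw => /(_ isT).
by rewrite unfold_in => ->.
Qed.

(** Deleting [v] is a bijection onto the [m]-subsets of its out-neighbourhood; irreflexivity lets
    [v] be added back as a new element. *)
Lemma card_draws_source m v :
  #|[set A : {set V} | (#|A| == m.+1) && source A v]| = 'C(#|t v|, m).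
Proof.
pose B := [set x in t v].
have <- : #|B| = #|t v| by rewrite cardsE.
rewrite -cards_draws -(@card_in_imset _ _ (fun A => A :\ v)); last first.
  move=> A A'; rewrite !inE => /andP[_ /andP[vA _]] /andP[_ /andP[vA' _]] E.
  by rewrite -(setD1K vA) E setD1K.
apply: eq_card => A; apply/imsetP/idP => [[A' + ->]|].
  rewrite !inE => /and3P[/eqP cA vA sA]; apply/andP; split; last first.
    by move: cA; rewrite (cardsD1 v) vA add1n => /succn_inj ->.
  by apply/subsetP => x /(subsetP sA) tx; rewrite inE.
rewrite inE => /andP[/subsetP sA /eqP cA].
have vA : v \notin A by apply: contra (t_irr v) => /sA; rewrite inE.
exists (v |: A); last by rewrite setU1K.
rewrite inE cardsU1 vA cA eqxx /source setU11 setU1K//=.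
by apply/subsetP => x /sA; rewrite inE.
Qed.

(** Double counting of pairs (set, source): each set counted has exactly one source. *)
Lemma card_with_source m :
  #|[set A : {set V} | (#|A| == m.+1) && [exists v, source A v]]|
    = \sum_v 'C(#|t v|, m).
Proof.
rewrite -sum1_card.
under [RHS]eq_bigr => v _ do rewrite -card_draws_source -sum1_card big_mkcond.
rewrite exchange_big big_mkcond; apply: eq_bigr => A _.
rewrite inE; case: ifP => [/andP[cA /existsP[v sv]]|nA].
  rewrite (bigD1 v)//= inE cA sv big1// => w nwv; rewrite inE cA /=.
  by case: ifP => // /(source_uniq sv) vw; rewrite vw eqxx in nwv.
rewrite big1// => v _; rewrite inE; case: ifP => // /andP[cA sv].
by move: nA => /negP[]; rewrite cA; apply/existsP; exists v.
Qed.

Lemma card_cyclic_triples :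
  #|cyclic_triples| + \sum_v 'C(#|t v|, 2) = 'C(#|V|, 3).
Proof.
rewrite -card_with_source -card_draws.
rewrite -(cardsID [set A | [exists v, source A v]] [set A : {set V} | #|A| == 3]).
rewrite addnC; congr (_ + _); apply: eq_card => A; rewrite !inE//.
by rewrite andbC.
Qed.

(** The case of pairs: every pair has a source, namely the tail of its arc. *)
Lemma sum_outdegree : \sum_v #|t v| = 'C(#|V|, 2).
Proof.
under eq_bigr => v _ do rewrite -[#|_|]bin1.
rewrite -card_with_source -card_draws; apply: eq_card => A; rewrite !inE.
apply: andb_idr => /cards2P[x [y [nxy ->]]]; apply/existsP.
wlog txy : x y nxy / t x y.
  move=> H; case: (boolP (t x y)) => [|nt]; first exact: H.
  rewrite setUC; apply: H; first by rewrite eq_sym.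
  by rewrite t_total// eq_sym.
exists x; rewrite /source !inE eqxx/=; apply/subsetP => z; rewrite !inE.
by case: eqP => //= _ /eqP ->.
Qed.

End Tournament.

(** * Binomial arithmetic of the bound *)

Lemma bin2E m : 'C(m.+2, 2) * 2 = m.+2 * m.+1.
Proof. by rewrite bin_ffact !ffactnS ffactn0 muln1. Qed.

Lemma bin3E m : 'C(m.+2, 3) * 6 = m.+2 * m.+1 * m.
Proof. by rewrite (bin_ffact _ 3) !ffactnS ffactn0 muln1 mulnA. Qed.

(** With h = [n./2], summing the tangent estimate (h-1)d - C(h,2) <= C(d,2) over outdegrees bounds
    the number of triples with a source from below. This identity says that subtracting that bound
    from C(n,3) leaves [max_intersecting n]; it is written additively to avoid truncated
    subtraction. *)
Lemma max_intersectingE n : 1 < n ->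
  max_intersecting n + n./2.-1 * 'C(n, 2) = 'C(n, 3) + n * 'C(n./2, 2).
Proof.
rewrite /max_intersecting => n1.
have [h [b nE]] : exists h (b : bool), n = h.*2.+2 + b.
  by exists (n./2.-1), (odd n); lia.
have hE : n./2 = h.+1 by lia.
have E3 : 'C(h.+3, 3) * 6 = h.+3 * h.+2 * h.+1 by rewrite bin3E.
have E2 : 'C(h.+2, 3) * 6 = h.+2 * h.+1 * h by rewrite bin3E.
have F : 'C(h.+1, 2) * 2 = h.+1 * h.
  by rewrite bin_ffact !ffactnS ffactn0 muln1.
have -> : (n + 2)./2 = h.+2 by lia.
rewrite hE nE {n n1 nE hE}; case: b.
  have -> : uphalf (h.*2.+2 + true + 2) = h.+3 by lia.
  have -> : h.*2.+2 + true = h.*2.+3 by rewrite addn1.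
  have -> : 'C(h.*2.+3, 2) = h.*2.+3 * h.+1 by have := bin2E h.*2.+1; nia.
  by rewrite -pred_Sn; move: (bin3E h.*2.+1); nia.
have -> : uphalf (h.*2.+2 + false + 2) = h.+2 by lia.
have -> : h.*2.+2 + false = h.*2.+2 by rewrite addn0.
have -> : 'C(h.*2.+2, 2) = h.*2.+1 * h.+1 by have := bin2E h.*2; nia.
have -> : h.*2.+2 * 'C(h.+1, 2) = h.+1 * (h.+1 * h) by rewrite -F; lia.
rewrite -pred_Sn -mul2n; have := bin3E (2 * h); lia.
Qed.

(* Twice the gap is [(d - h) * (d - h + 1)], which vanishes only at consecutive
   integers. *)
Lemma bin2_tangent h d : 0 < h -> h.-1 * d <= 'C(d, 2) + 'C(h, 2) ?= iff
  (d == h) || (d == h.-1).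
Proof.
case: h => // h _; have Fh : 'C(h.+1, 2) * 2 = h.+1 * h.
  by rewrite bin_ffact !ffactnS ffactn0 muln1.
have Fd : 'C(d, 2) * 2 + d = d * d.
  by rewrite bin_ffact !ffactnS ffactn0 muln1; case: d => // d; rewrite mulnS addnC.
have [hd|dh] := ltnP h d.
  have [e dE] : exists e, d = h.+1 + e by exists (d - h.+1); lia.
  split; first by subst d; nia.
  have [e0|e0] : e = 0 \/ 0 < e by lia.
    by subst; apply/eqP/orP; [left; rewrite addn0|nia].
  by apply/eqP/idP; subst d; nia.
have [e hE] : exists e, h = d + e by exists (h - d); lia.
split; first by subst h; nia.
by apply/eqP/orP => [H|[]/eqP dE]; subst h; nia.
Qed.

(** Sum [bin2_tangent] over all vertices. The inequality serves the upper bound, the equality case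
    the balanced tournament. *)
Lemma card_cyclic_triples_leqif (V : finType) (t : rel V) :
    (forall x, ~~ t x x) -> (forall x y, x != y -> t x y = ~~ t y x) ->
    1 < #|V| ->
  #|cyclic_triples t| <= max_intersecting #|V| ?= iff
    [forall v, (#|t v| == #|V|./2) || (#|t v| == #|V|./2.-1)].
Proof.
move=> t_irr t_total V1; have V2 : 0 < #|V|./2 by lia.
have := card_cyclic_triples t_irr t_total; have := max_intersectingE V1.
rewrite -(sum_outdegree t_irr t_total) big_distrr/= => M C.
have := leqif_sum (fun v _ => bin2_tangent #|t v| V2) (P := predT).
rewrite big_split/= sum_nat_const -[#|xpredT|]/#|V| => -[].
move: M C; move: (bigop _ _ _) (bigop _ _ _) => s1 s2.
move: (_ * _) 'C(_, 3) (max_intersecting _) #|cyclic_triples t| => p q m c.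
by move=> M C L <-; split; lia.
Qed.

(** * The balanced circular tournament *)

Section Balanced.
Variable n : nat.

(* Every point dominates those at cyclic distance at most [n./2] ahead of it;
   for even [n], antipodal pairs are oriented from the smaller index. *)
Definition balanced (i j : 'I_n) :=
  if i < j then j - i <= n./2 else (j < i) && (n./2 < i - j).

Lemma balanced_lt (i j : 'I_n) : i < j -> balanced i j = (j - i <= n./2).
Proof. by rewrite /balanced => ->. Qed.

Lemma balanced_gt (i j : 'I_n) : i < j -> balanced j i = (n./2 < j - i).
Proof. by rewrite /balanced => ij; rewrite ij ltnNge ltnW. Qed.

Lemma balanced_irr i : ~~ balanced i i.
Proof. by rewrite /balanced ltnn. Qed.

Lemma balanced_total i j : i != j -> balanced i j = ~~ balanced j i.
Proof. by rewrite -val_eqE /balanced /=; case: ltngtP => //=; lia. Qed.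

Lemma balanced_outdegree i : #|balanced i| \in [:: n./2; n./2.-1].
Proof.
(* Partial sums up to [m] allow induction. The two terms count the out-neighbours below [i - n./2]
   and those from [i.+1] to [i + n./2]. *)
suff E m : \sum_(j < m) (if (if i < j then j - i <= n./2
    else (j < i) && (n./2 < i - j)) then 1 else 0)
    = minn m (i - n./2) + (minn m (i + n./2).+1 - minn m i.+1).
  rewrite -sum1_card big_mkcond /= (E n).
  by have := ltn_ord i; rewrite !inE; lia.
elim: m => [|m IH]; first by rewrite big_ord0; lia.
by rewrite big_ord_recr /= IH; case: (ltnP i m) => im; case: ifP; lia.
Qed.

Lemma card_cyclic_balanced : 1 < n ->
  #|cyclic_triples balanced| = max_intersecting n.
Proof.
move=> n1; have := card_cyclic_triples_leqif balanced_irr balanced_total.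
rewrite card_ord => /(_ n1) [_ E]; apply/eqP; rewrite E.
by apply/forallP => i; have := balanced_outdegree i; rewrite !inE.
Qed.

(** List the triple in increasing order. Without a source it is a cycle i -> j -> k -> i or its
    reverse; the reverse would need k - i <= [n./2] < j - i, impossible as j < k. *)
Lemma cyclic_balancedP A : A \in cyclic_triples balanced ->
  exists i j k : 'I_n, [/\ A = [set i; j; k], i < j, j < k &
    [/\ j - i <= n./2, k - j <= n./2 & n./2 < k - i]].
Proof.
rewrite inE cardE => /andP[/eqP + /existsPn nA].
have : sorted (fun i j : 'I_n => i < j) (enum A).
  rewrite /enum_mem sorted_filter//; first by move=> ? ? ?; apply: ltn_trans.
  by have := iota_ltn_sorted 0 n; rewrite -val_enum_ord sorted_map enumT.
have AE : A = [set x in enum A] by apply/setP => x; rewrite inE mem_enum.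
case E : (enum A) AE => [|i [|j [|k []]]]//= AE /and3P[ij jk _] _.
have {}AE : A = [set i; j; k] by rewrite AE; apply/setP => x; rewrite !inE orbA.
exists i, j, k; split=> //.
have S x y z : A = [set x; y; z] -> ~~ (balanced x y && balanced x z).
  move=> Axyz; apply: contra (nA x) => /andP[xy xz].
  rewrite /source Axyz !inE eqxx/=; apply/subsetP => w.
  by rewrite !inE unfold_in; case: eqP => //= _ /orP[]/eqP ->.
have Si := S i j k AE.
have Sj : ~~ (balanced j i && balanced j k) by apply: S; rewrite AE (setUC [set i]).
have Sk : ~~ (balanced k i && balanced k j) by apply: S; rewrite AE setUC setUA.
have ik := ltn_trans ij jk; move: Si Sj Sk.
by rewrite !(balanced_lt ij, balanced_lt jk, balanced_lt ik, balanced_gt ij,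
  balanced_gt jk, balanced_gt ik); split; lia.
Qed.

End Balanced.

(** The chords ab and cd interleave on the circle, each listed with its smaller end first. *)
Definition crossing (a b c d : nat) :=
  (a < c < b) && (b < d) || (c < a < d) && (d < b).

(* A vertex of one triple strictly inside an arc cut off by the other forces
   the whole triple into that arc, which is too short to contain it. *)
Lemma balanced_crossing n h i j k i' j' k' : n <= h.*2.+1 ->
  i < j -> j < k -> k < n -> j - i <= h -> k - j <= h -> h < k - i ->
  i' < j' -> j' < k' -> k' < n -> j' - i' <= h -> k' - j' <= h -> h < k' - i' ->
  [|| i != i', j != j' | k != k'] ->
  exists a b c d, [/\ a \in [:: i; j; k], b \in [:: i; j; k],
    c \in [:: i'; j'; k'], d \in [:: i'; j'; k'] & crossing a b c d].
Proof.
move=> nh ij jk kn ijh jkh ikh ij' jk' kn' ijh' jkh' ikh' neq.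
apply: contrapT => noX.
(* Without crossings, one vertex strictly between [p] and [q] confines the second triple to the
   closed arc. *)
have inside p q c d : p \in [:: i; j; k] -> q \in [:: i; j; k] ->
    c \in [:: i'; j'; k'] -> d \in [:: i'; j'; k'] ->
    p < c < q -> p <= d <= q.
  move=> pS qS cT dT pcq; apply/negPn/negP => dpq; apply: noX.
  have [dp|pd] := ltnP d p; [exists p, q, d, c|exists p, q, c, d];
    by split=> //; rewrite /crossing; lia.
have S x : (x \in [:: i; j; k]) = [|| x == i, x == j | x == k].
  by rewrite !inE.
have T x : (x \in [:: i'; j'; k']) = [|| x == i', x == j' | x == k'].
  by rewrite !inE.
(* Otherwise [i'] and [k'] both lie between [i] and [j], so k' - i' <= j - i <= h. *)
have nij c : c \in [:: i'; j'; k'] -> ~~ (i < c < j).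
  move=> cT; apply/negP => icj.
  have := inside i j c i'; have := inside i j c k'.
  by rewrite !S cT !T icj !eqxx ?orbT; lia.
have njk c : c \in [:: i'; j'; k'] -> ~~ (j < c < k).
  move=> cT; apply/negP => icj.
  have := inside j k c i'; have := inside j k c k'.
  by rewrite !S cT !T icj !eqxx ?orbT; lia.
have nik c : c \in [:: i'; j'; k'] -> i <= c <= k.
  move=> cT; apply/negPn/negP => nc.
  have out d : d \in [:: i'; j'; k'] -> ~~ (i < d < k).
    by move=> dT; apply: contra nc; apply: inside; rewrite ?S ?eqxx ?orbT.
  have := out i'; have := out j'; have := out k'.
  by rewrite !T !eqxx !orbT; lia.
(* So every vertex of the second triple is one of the first, and the increasing triples coincide. *)
have V c : c \in [:: i'; j'; k'] -> [|| c == i, c == j | c == k].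
  by move=> cT; have := nij c cT; have := njk c cT; have := nik c cT; lia.
have := V i'; have := V j'; have := V k'.
by rewrite !T !eqxx !orbT; lia.
Qed.

From mathcomp Require Import all_classical all_reals all_analysis.
Import Order.TTheory GRing.Theory Num.Theory.
Import numFieldNormedType.Exports.

(** * Triangles in the plane *)

Section Plane.
Local Open Scope classical_set_scope.
Local Open Scope ring_scope.
Variable R : realType.
Local Notation pt := 'rV[R]_2.
Implicit Types a b c d e f x y : pt.

Definition px a : R := a ord0 ord0.
Definition py a : R := a ord0 ord_max.

Lemma pt_eqP a b : px a = px b -> py a = py b -> a = b.
Proof.
move=> ex ey; apply/rowP => i.
have [->|->] : i = ord0 \/ i = ord_max.
- by case: i => [[|[|//]] ?]; [left|right]; apply: val_inj.
- exact: ex.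
- exact: ey.
Qed.

Lemma pxD a b : px (a + b) = px a + px b. Proof. by rewrite /px mxE. Qed.
Lemma pyD a b : py (a + b) = py a + py b. Proof. by rewrite /py mxE. Qed.
Lemma pxN a : px (- a) = - px a. Proof. by rewrite /px mxE. Qed.
Lemma pyN a : py (- a) = - py a. Proof. by rewrite /py mxE. Qed.
Lemma pxZ t a : px (t *: a) = t * px a. Proof. by rewrite /px mxE. Qed.
Lemma pyZ t a : py (t *: a) = t * py a. Proof. by rewrite /py mxE. Qed.
Definition pxyE := (pxD, pyD, pxN, pyN, pxZ, pyZ).

(** Twice the signed area of the triangle abc, positive when it is counterclockwise. *)
Definition orient a b c : R :=
  (px b - px a) * (py c - py a) - (py b - py a) * (px c - px a).

Lemma orient_rot a b c : orient b c a = orient a b c.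
Proof. by rewrite /orient; ring. Qed.

Lemma orient_swap a b c : orient b a c = - orient a b c.
Proof. by rewrite /orient; ring. Qed.

Lemma orient_flip a b c : orient a c b = - orient a b c.
Proof. by rewrite /orient; ring. Qed.

Lemma continuous_orient a b : continuous (orient a b).
Proof.
have cx : continuous px by exact: coord_continuous.
have cy : continuous py by exact: coord_continuous.
have cst (r : R) : continuous ((fun=> r) : pt -> R).
  exact: cst_continuous.
move=> x; apply: (@continuousB R R^o pt
  (fun c => (px b - px a) * (py c - py a)) (fun c => (py b - py a) * (px c - px a))).
  apply: (@continuousM R pt (fun=> px b - px a) (fun c => py c - py a)).
    exact: cst.
  apply: (@continuousB R R^o pt py (fun=> py a)); [exact: cy|exact: cst].
apply: (@continuousM R pt (fun=> py b - py a) (fun c => px c - px a)).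
  exact: cst.
apply: (@continuousB R R^o pt px (fun=> px a)); [exact: cx|exact: cst].
Qed.

(** * Convex hulls, interiors and half-planes *)

Lemma conv_hull_convex (A : set pt) x y (t : R) : 0 <= t <= 1 ->
  conv_hull A x -> conv_hull A y -> conv_hull A (t *: x + (1 - t) *: y).
Proof.
move=> /andP[t0 t1] Ax Ay C [Cc AC].
have Cx : x \in C by rewrite inE; apply: Ax.
have Cy : y \in C by rewrite inE; apply: Ay.
by have := Cc x y (Itv01 t0 t1) Cx Cy; rewrite inE.
Qed.

Lemma sub_conv_hull (A : set pt) : A `<=` conv_hull A.
Proof. exact: sub_gen_smallest. Qed.

Lemma conv_hull_combination (A : set pt) a b c (u v w : R) :
  0 < u -> 0 < v -> 0 < w -> u + v + w = 1 -> A a -> A b -> A c ->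
  conv_hull A (u *: a + v *: b + w *: c).
Proof.
move=> u0 v0 w0 uvw Aa Ab Ac; have w1 : 0 < 1 - u by lra.
(* Convexity is binary: mix [b] and [c] first, then [a]. Positivity of [v] and [w] makes the divisor
   1 - u nonzero. *)
have -> : u *: a + v *: b + w *: c =
    u *: a + (1 - u) *: ((v / (1 - u)) *: b + (1 - v / (1 - u)) *: c).
  rewrite scalerDr !scalerA addrA mulrBr mulr1 mulrCA divff ?gt_eqF// mulr1.
  by congr (_ + _ *: _); lra.
apply: conv_hull_convex; [lra|exact: (sub_conv_hull Aa)|].
apply: conv_hull_convex; [|exact: (sub_conv_hull Ab)|exact: (sub_conv_hull Ac)].
by rewrite divr_ge0 ?ler_pdivrMr//; lra.
Qed.

(** Barycentric coordinates as ratios of signed areas (Cramer's rule). *)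
Lemma orient_combination a b c x : orient a b c != 0 ->
  x = (orient b c x / orient a b c) *: a + (orient c a x / orient a b c) *: b
      + (orient a b x / orient a b c) *: c.
Proof.
move=> abc; apply: pt_eqP; rewrite !pxyE; move: abc; rewrite /orient => abc.
all: by field.
Qed.

Lemma orient_sum a b c x :
  orient b c x + orient c a x + orient a b x = orient a b c.
Proof. by rewrite /orient; ring. Qed.

Lemma conv_hull_triangle (A : set pt) a b c x : A a -> A b -> A c ->
  0 < orient a b x -> 0 < orient b c x -> 0 < orient c a x -> conv_hull A x.
Proof.
move=> Aa Ab Ac abx bcx cax; have abc : 0 < orient a b c.
  by rewrite -(orient_sum a b c x); lra.
rewrite (@orient_combination a b c x) ?gt_eqF//.
apply: conv_hull_combination => //; try exact: divr_gt0.
by rewrite -!mulrDl orient_sum divff ?gt_eqF.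
Qed.

(** The three strict inequalities are open conditions, so they persist near [x]. *)
Lemma interior_triangle_ccw (A : set pt) a b c x : A a -> A b -> A c ->
  0 < orient a b x -> 0 < orient b c x -> 0 < orient c a x ->
  (conv_hull A)° x.
Proof.
move=> Aa Ab Ac abx bcx cax.
have pos p q : 0 < orient p q x -> \forall y \near x, 0 < orient p q y.
  by move=> pqx; have /cvgr_gt/(_ _ pqx) := @continuous_orient p q x.
rewrite /interior; near=> y; apply: (@conv_hull_triangle A a b c) => //.
- by near: y; exact: pos.
- by near: y; exact: pos.
- by near: y; exact: pos.
Unshelve. all: by end_near. Qed.

(** The factor [orient a b c] covers both orientations; a clockwise triangle is reversed by swapping
    [a] and [b]. *)
Lemma interior_triangle (A : set pt) a b c x : A a -> A b -> A c ->
  0 < orient a b c * orient a b x -> 0 < orient a b c * orient b c x ->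
  0 < orient a b c * orient c a x -> (conv_hull A)° x.
Proof.
move=> Aa Ab Ac; have [abc|abc|<-] := ltgtP 0 (orient a b c).
- by rewrite !pmulr_rgt0//; exact: interior_triangle_ccw.
- rewrite !nmulr_rgt0// => abx bcx cax.
  by apply: (@interior_triangle_ccw A b a c) => //; rewrite orient_swap oppr_gt0.
- by rewrite mul0r ltxx.
Qed.

Lemma conv_hull_halfplane (A : set pt) a b x :
  (forall p, A p -> 0 <= orient a b p) -> conv_hull A x -> 0 <= orient a b x.
Proof.
move=> Aab; apply: (@smallest_sub _ (@convex_set R pt) A [set p | 0 <= orient a b p]).
  move=> y z t; rewrite !inE /= => y0 z0.
  rewrite -[conv t y z]/(t%:inum *: y + (1 - t%:inum) *: z).
  have -> : orient a b (t%:inum *: y + (1 - t%:inum) *: z) =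
     t%:inum * orient a b y + (1 - t%:inum) * orient a b z.
    by rewrite /orient !pxyE; ring.
  by rewrite addr_ge0// mulr_ge0// subr_ge0.
exact: Aab.
Qed.

(** From an interior point one can still move a little towards the line within the hull, so the
    point is not on the line. *)
Lemma interior_halfplane (A : set pt) a b x : a != b ->
  (forall p, A p -> 0 <= orient a b p) -> (conv_hull A)° x ->
  0 < orient a b x.
Proof.
move=> ab Aab /nbhs_ballP[e e0 xe].
(* [w] is [b - a] turned left by a right angle; [t] makes the displacement [t *: w] shorter than
   [e]. *)
pose w : pt := \row_i (if i == ord0 then - (py b - py a) else px b - px a).
pose t := e / 2 / (1 + `|w|).
have w1 : 0 < 1 + `|w| by have := normr_ge0 w; lra.
have t0 : 0 < t by rewrite !divr_gt0.
have /xe/(conv_hull_halfplane Aab) : ball x e (x - t *: w).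
  rewrite -ball_normE /= opprD addNKr opprK normrZ gtr0_norm//.
  rewrite /t mulrAC ltr_pdivrMr//.
  by have := mulr_ge0 (ltW e0) (normr_ge0 w); rewrite /= in e0 *; lra.
have -> : orient a b (x - t *: w) =
    orient a b x - t * ((px b - px a) ^+ 2 + (py b - py a) ^+ 2).
  have [wx wy] : px w = - (py b - py a) /\ py w = px b - px a.
    by rewrite /px /py !mxE.
  by rewrite /orient !pxyE wx wy; ring.
suff : 0 < (px b - px a) ^+ 2 + (py b - py a) ^+ 2 by nra.
rewrite lt_neqAle addr_ge0 ?sqr_ge0// andbT eq_sym paddr_eq0 ?sqr_ge0//.
rewrite !sqrf_eq0 !subr_eq0; apply: contra ab => /andP[/eqP bx /eqP b_y].
by apply/eqP/pt_eqP.
Qed.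

(** * Triangles with properly crossing edges *)

Lemma small_perturbation (p q : R) : 0 < p ->
  exists2 e, 0 < e & forall t, 0 < t -> t <= e -> 0 < p + t * q.
Proof.
move=> p0; have q1 : 0 < 1 + `|q| by have := normr_ge0 q; lra.
(* Then t + t|q| <= p, so t|q| < p; the added 1 keeps the divisor positive when q = 0. *)
exists (p / (1 + `|q|)); first exact: divr_gt0.
move=> t t0; rewrite ler_pdivlMr// => tp.
have : - (t * `|q|) <= t * q.
  by rewrite -mulrN ler_pM2l// lerNl -normrN ler_norm.
lra.
Qed.

(** Near a point inside the edge ab the triangle abe looks like a half-plane, and so does cdf near a
    point inside cd. Properly crossing edges are not parallel, so some direction from the crossing
    point enters both half-planes. *)
Lemma crossing_interiors (A B : set pt) a b c d e f :
  A a -> A b -> A e -> B c -> B d -> B f ->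
  orient a b e != 0 -> orient c d f != 0 ->
  orient a b c < 0 -> 0 < orient a b d -> 0 < orient c d a -> orient c d b < 0 ->
  (conv_hull A)° `&` (conv_hull B)° !=set0.
Proof.
move=> Aa Ab Ae Bc Bd Bf abe cdf abc abd cda cdb.
(* [s] and [u] are the parameters of the crossing point along ab and cd; their common denominator
   [K] is the cross product of [b - a] and [d - c]. *)
pose s := orient c d a / (orient c d a - orient c d b).
pose K := orient a b d - orient a b c.
have K0 : 0 < K by rewrite subr_gt0 (lt_trans abc).
have KE : orient c d a - orient c d b = K by rewrite /K /orient; ring.
have s01 : 0 < s < 1.
  by rewrite /s KE divr_gt0//= ltr_pdivrMr// mul1r -KE; lra.
pose u := - orient a b c / K.
have u01 : 0 < u < 1.
  by rewrite /u divr_gt0 ?oppr_gt0//= ltr_pdivrMr// mul1r /K; lra.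
pose x := a + s *: (b - a).
have xE : x = c + u *: (d - c).
  apply: pt_eqP; rewrite !pxyE /s /u KE; move: K0; rewrite lt0r => /andP[+ _];
    rewrite /K /orient => K0; field; exact: K0.
(* [x] is the crossing point, and [v] points into both triangles there. *)
pose v := orient a b e *: (d - c) - orient c d f *: (b - a).
(* For [z] on the edge pq, displacement decides the sign with respect to pq, while the other two
   values start from positive multiples of [orient p q r] and survive a small [t]. *)
have bary p q r (z w : pt) t l : z = p + l *: (q - p) ->
    [/\ orient p q (z + t *: w) = t * orient p q (p + w),
    orient q r (z + t *: w) = (1 - l) * orient p q r + t * orient q r (q + w) &
    orient r p (z + t *: w) = l * orient p q r + t * orient r p (r + w)].
  by move=> ->; rewrite /orient !pxyE; split; ring.
have vab : orient a b (a + v) = orient a b e * K.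
  by rewrite /v /K; move: (orient a b e) (orient c d f) => g h;
    rewrite /orient !pxyE; ring.
have vcd : orient c d (c + v) = orient c d f * K.
  by rewrite /v /K; move: (orient a b e) (orient c d f) => g h;
    rewrite /orient !pxyE; ring.
have pos z l : 0 < l -> z != 0 -> 0 < l * (z * z : R).
  by move=> l0 z0; rewrite mulr_gt0// -expr2 exprn_even_gt0.
have [e1 e10 E1] := small_perturbation (orient a b e * orient b e (b + v))
  (pos (orient a b e) (1 - s) ltac:(lra) abe).
have [e2 e20 E2] := small_perturbation (orient a b e * orient e a (e + v))
  (pos (orient a b e) s ltac:(lra) abe).
have [e3 e30 E3] := small_perturbation (orient c d f * orient d f (d + v))
  (pos (orient c d f) (1 - u) ltac:(lra) cdf).
have [e4 e40 E4] := small_perturbation (orient c d f * orient f c (f + v))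
  (pos (orient c d f) u ltac:(lra) cdf).
pose t := Num.min (Num.min e1 e2) (Num.min e3 e4).
have t0 : 0 < t by rewrite !lt_min e10 e20 e30.
have [t1 t2 t3 t4] : [/\ t <= e1, t <= e2, t <= e3 & t <= e4].
  by rewrite !ge_min !lexx !orbT.
have [ab be ea] := bary a b e x v t s erefl.
have [cd df fc] := bary c d f x v t u xE.
exists (x + t *: v); split.
- apply: (interior_triangle Aa Ab Ae).
  + by rewrite ab vab mulrCA mulr_gt0// mulrA mulrC pos.
  + by have := E1 t t0 t1; rewrite be; lra.
  + by have := E2 t t0 t2; rewrite ea; lra.
- apply: (interior_triangle Bc Bd Bf).
  + by rewrite cd vcd mulrCA mulr_gt0// mulrA mulrC pos.
  + by have := E3 t t0 t3; rewrite df; lra.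
  + by have := E4 t t0 t4; rewrite fc; lra.
Qed.

End Plane.

(** * Counterclockwise enumeration of points in convex position *)

Section ConvexOrder.
Local Open Scope classical_set_scope.
Local Open Scope ring_scope.
Variables (R : realType) (P : {fset 'rV[R]_2}).
Local Notation pt := 'rV[R]_2.
Implicit Types a b c d : pt.

Lemma orient0_line a b c : a != b -> orient a b c = 0 ->
  exists t, c = a + t *: (b - a).
Proof.
move=> ab abc0; have [bx|bx] := eqVneq (px b - px a) 0; last first.
  exists ((px c - px a) / (px b - px a)); apply: pt_eqP; rewrite !pxyE.
    by field.
  move: abc0; rewrite /orient => /eqP; rewrite subr_eq0 => /eqP H.
  have -> : (px c - px a) / (px b - px a) * (py b - py a) = py c - py a.
    by rewrite mulrAC; apply: (canLR (mulfK bx)); rewrite mulrC -H mulrC.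
  by ring.
have b_y : py b - py a != 0.
  by apply: contraNneq ab => b_y; apply/eqP/pt_eqP; lra.
exists ((py c - py a) / (py b - py a)); apply: pt_eqP; rewrite !pxyE.
  rewrite bx mulr0 addr0; move: abc0; rewrite /orient bx mul0r sub0r.
  by move=> /eqP; rewrite oppr_eq0 mulf_eq0 (negbTE b_y) subr_eq0 => /eqP.
by field.
Qed.

Lemma orient_neq0 a b c : no_three_collinear P ->
  a \in P -> b \in P -> c \in P -> a != b -> a != c -> b != c ->
  orient a b c != 0.
Proof.
move=> hcol aP bP cP ab ac bc; apply/eqP => abc0.
apply: (hcol (a |` (b |` [fset c]))%fset).
- by apply/fsubsetP => x; rewrite !inE => /or3P[] /eqP ->.
- by rewrite !cardfsU1 cardfs1 !inE negb_or ab ac bc.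
exists a, (b - a); split; first by rewrite subr_eq0 eq_sym.
move=> x /=; rewrite !inE => /or3P[] /eqP ->; last exact: orient0_line.
- by exists 0; rewrite scale0r addr0.
- by exists 1; rewrite scale1r addrC subrK.
Qed.

(** Strict positivity also separates [d] from the vertices, so [d] would lie in the hull of the
    other points of [P]. *)
Lemma convex_position_outside a b c d : convex_position P ->
  a \in P -> b \in P -> c \in P -> d \in P ->
  0 < orient a b d -> 0 < orient b c d -> 0 < orient c a d -> False.
Proof.
move=> hconv aP bP cP dP abd bcd cad; apply: (hconv d dP).
have out x y : 0 < orient x y d -> x != d /\ y != d.
  move=> xyd; split; apply: contraTneq xyd => ->;
    rewrite -leNgt le_eqVlt; apply/orP; left; apply/eqP; rewrite /orient; ring.
have [ad bd] := out _ _ abd; have [_ cd] := out _ _ bcd.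
by apply: (conv_hull_triangle _ _ _ abd bcd cad); rewrite /= !inE; apply/andP.
Qed.

(** Fix a point [p] and sort the others by angle around it. Convex position makes this angular
    comparison transitive and then fixes the orientation of triples avoiding [p]. *)
Lemma convex_ccw_enumeration : convex_position P -> no_three_collinear P ->
  exists s : seq pt, [/\ uniq s, s =i P & forall i j k : nat,
    (i < j)%N -> (j < k)%N -> (k < size s)%N ->
    0 < orient (nth 0 s i) (nth 0 s j) (nth 0 s k)].
Proof.
move=> hconv hcol.
have [->|[p pP]] := fset_0Vmem P.
  by exists [::]; split=> // x; rewrite inE.
pose Q : pred pt := fun x => (x \in P) && (x != p).
pose le x y := (x == y) || (0 < orient p x y).
have le_total : {in Q &, total le}.
  move=> x y /andP[xP xp] /andP[yP yp]; rewrite /le (eq_sym y).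
  have [//|xy] := eqVneq x y; rewrite /= (orient_flip p x y) oppr_gt0.
  by rewrite -neq_lt eq_sym orient_neq0// eq_sym.
have le_trans : {in Q & &, transitive le}.
  move=> y x z /andP[yP yp] /andP[xP xp] /andP[zP zp].
  rewrite /le; have [->//|xy] := eqVneq x y; have [->|yz] := eqVneq y z.
    by move=> /= -> _; rewrite orbT.
  rewrite /= => pxy pyz; have [//|xz] := eqVneq x z; rewrite /= ltNge; apply/negP => pxz.
  have : orient p x z != 0 by apply: orient_neq0; rewrite // eq_sym.
  (* A cyclic comparison of x, y, z around [p] would put [p] inside the triangle xyz. *)
  move=> pxz0; apply: (@convex_position_outside x y z p) => //.
  - by rewrite orient_rot.
  - by rewrite orient_rot.
  - by rewrite orient_rot orient_flip oppr_gt0 lt_neqAle pxz0.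
pose t := sort le [seq x <- enum_fset P | x != p].
have tQ : {subset t <= Q}.
  by move=> x; rewrite mem_sort mem_filter /Q andbC.
have t_sorted : sorted le t.
  apply: (sort_sorted_in le_total); apply/allP => x; rewrite mem_filter => /andP[xp xP].
  by apply/andP.
have t_uniq : uniq t by rewrite sort_uniq filter_uniq ?fset_uniq.
have t_lt i j : (i < j)%N -> (j < size t)%N -> 0 < orient p (nth 0 t i) (nth 0 t j).
  move=> ij jt; have it := ltn_trans ij jt.
  have allQ : all Q t by apply/allP => x /tQ.
  have := sorted_ltn_nth_in le_trans 0 allQ t_sorted i j it jt ij.
  by rewrite /le nth_uniq// (ltn_eqF ij).
exists (p :: t); split.
- by rewrite /= t_uniq andbT; apply/negP => /tQ /andP[_]; rewrite eqxx.
- move=> x; rewrite inE mem_sort mem_filter.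
  by have [->|xp] := eqVneq x p.
move=> [|i] [|j] [|k]//=; rewrite !ltnS => ij jk kt; first exact: t_lt.
have jt := ltn_trans jk kt; have it := ltn_trans ij jt.
have ik := ltn_trans ij jk.
have tP l : (l < size t)%N -> nth 0 t l \in P /\ nth 0 t l != p.
  by move=> lt; apply/andP/tQ/mem_nth.
have [iP ip] := tP i it; have [jP jp] := tP j jt; have [kP kp] := tP k kt.
rewrite ltNge; apply/negP => ijk0.
have ijk : orient (nth 0 t i) (nth 0 t j) (nth 0 t k) != 0.
  by apply: orient_neq0; rewrite ?nth_uniq ?ltn_eqF.
(* A clockwise triple would put its middle point inside the triangle formed by [p] and the outer
   two. *)
apply: (@convex_position_outside p (nth 0 t i) (nth 0 t k) (nth 0 t j)) => //.
- exact: t_lt.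
- by rewrite orient_flip oppr_gt0 lt_neqAle ijk.
- by rewrite -orient_rot; exact: t_lt.
Qed.

End ConvexOrder.

(** * Families of triangles *)

Section Families.
Local Open Scope fset_scope.
Local Open Scope ring_scope.
Variables (R : realType) (n : nat) (P : {fset 'rV[R]_2}) (p : 'I_n -> 'rV[R]_2).
Hypothesis p_inj : injective p.
Hypothesis pP : forall x, x \in P <-> exists i, x = p i.
Hypothesis hcol : no_three_collinear P.
Implicit Types (A B : {set 'I_n}) (i j k : 'I_n) (T : {fset 'rV[R]_2}).

Definition triangle A : {fset 'rV[R]_2} := [fset p i | i in A].

Lemma mem_triangle A i : (p i \in triangle A) = (i \in A).
Proof. by apply/imfsetP/idP => [[j jA /p_inj ->]|iA]; [|exists i]. Qed.

Lemma triangle_inj : injective triangle.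
Proof. by move=> A B AB; apply/setP => i; rewrite -!mem_triangle AB. Qed.

Lemma card_triangle A : #|` triangle A| = #|A|.
Proof. by rewrite card_imfset//= -cardE. Qed.

Lemma triangle_sub A : triangle A `<=` P.
Proof. by apply/fsubsetP => _ /imfsetP[i _ ->]; apply/pP; exists i. Qed.

(** Lets spanned triangles be handled as sets of indices. *)
Lemma triangleE T : T `<=` P -> T = triangle [set i | p i \in T].
Proof.
move=> /fsubsetP TP; apply/fsetP => x; apply/idP/idP => [xT|].
  have /pP[i xi] := TP x xT; rewrite xi in xT *.
  by rewrite mem_triangle inE.
by move=> /imfsetP[i /=]; rewrite inE => iT ->.
Qed.

Lemma p_in i : p i \in P. Proof. by apply/pP; exists i. Qed.

Lemma orient_p_neq0 i j k : i != j -> i != k -> j != k ->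
  orient (p i) (p j) (p k) != 0.
Proof.
by move=> *; apply: (orient_neq0 hcol); rewrite ?p_in ?(inj_eq p_inj).
Qed.

(** * Upper bound: the tournament of free sides *)

Section Upper.
Variable F : {fset {fset 'rV[R]_2}}.
Hypothesis F_span : family_spanned_by P F.
Hypothesis F_int : intersecting_family F.

(** Some member of [F] lies in the closed left side of the line from [p i] to [p j]; by convexity
    testing its vertices suffices. *)
Definition occupied i j : bool :=
  `[< exists2 T, T \in F & forall x, x \in T -> 0 <= orient (p i) (p j) x >].

(** Distinct members on opposite closed sides would have disjoint interiors; a single member on both
    sides would be collinear. *)
Lemma occupied_asym i j : i != j -> occupied i j -> ~~ occupied j i.
Proof.
move=> ij /asboolP[S SF Sij]; apply/asboolPn => -[T TF Tji].
have pij : p i != p j by rewrite (inj_eq p_inj).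
have [ST|ST] := eqVneq S T; last first.
  have [x [Sx Tx]] := F_int SF TF ST.
  have := interior_halfplane pij Sij Sx.
  have := interior_halfplane _ Tji Tx; rewrite eq_sym pij => /(_ isT).
  by rewrite orient_swap; lra.
subst T; have [SP S3] := F_span SF; apply: (hcol SP S3).
exists (p i), (p j - p i); split; first by rewrite subr_eq0 eq_sym.
move=> x xS; apply: orient0_line => //; have := Sij x xS; have := Tji x xS.
by rewrite orient_swap; lra.
Qed.

(** When both sides are free, the arc leaves the smaller index, which makes this a tournament. *)
Definition free_side i j :=
  if (i < j)%N then ~~ occupied i j else (j < i)%N && occupied j i.

Lemma free_side_irr i : ~~ free_side i i.
Proof. by rewrite /free_side ltnn. Qed.

Lemma free_side_total i j : i != j -> free_side i j = ~~ free_side j i.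
Proof.
by rewrite -val_eqE /free_side /=; case: ltngtP => //=; rewrite negbK.
Qed.

Lemma free_sideN i j : free_side i j -> ~~ occupied i j.
Proof.
rewrite /free_side; case: ltngtP => //= ji; apply: occupied_asym.
by rewrite -val_eqE /= ltn_eqF.
Qed.

(** If [v] dominated [x] and [y], the left sides of vx and vy would both be free; but the triangle
    vxy lies to the left of vx or of vy, according to its orientation. *)
Lemma family_cyclic T : T \in F ->
  [set i | p i \in T] \in cyclic_triples free_side.
Proof.
move=> TF; have [TP T3] := F_span TF.
move: (triangleE TP); set A := [set i | _]; move: A => A TA.
have A3 : #|A| = 3%N by rewrite -card_triangle -TA.
rewrite inE A3 eqxx /=; apply/existsPn => v; apply/negP => /andP[vA].
have /cards2P[x [y [xy AE]]] : #|A :\ v| == 2%N.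
  by move: A3; rewrite (cardsD1 v) vA add1n => /succn_inj ->.
rewrite AE => /fintype.subsetP sv.
have := sv x; rewrite !inE eqxx => /(_ isT) /free_sideN /negP; apply.
have := sv y; rewrite !inE eqxx orbT => /(_ isT) /free_sideN /asboolPn vy.
exists T => // z.
have TE w : w \in T -> [\/ w = p v, w = p x | w = p y].
  rewrite TA => /imfsetP[i /=]; rewrite -(finset.setD1K vA) AE !inE.
  by case/or3P => /eqP -> ->; [apply: Or31|apply: Or32|apply: Or33].
have o1 a b : orient a b a = 0 :> R by rewrite /orient; ring.
have o2 a b : orient a b b = 0 :> R by rewrite /orient; ring.
case/TE => ->; rewrite ?o1 ?o2//.
rewrite leNgt; apply/negP => neg; apply: vy; exists T => // w.
case/TE => ->; rewrite ?o1 ?o2//.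
by rewrite orient_flip; lra.
Qed.

Lemma card_intersecting_family : (1 < n)%N ->
  (#|` F| <= max_intersecting n)%N.
Proof.
move=> n1; have := card_cyclic_triples_leqif free_side_irr free_side_total.
rewrite card_ord => /(_ n1) [+ _]; apply: leq_trans.
rewrite cardE -(size_map triangle); apply: uniq_leq_size => // T TF.
apply/mapP; exists [set i | p i \in T].
  by rewrite mem_enum family_cyclic.
by apply: triangleE; have [] := F_span TF.
Qed.

End Upper.

(** * Lower bound: the balanced family *)

Section Lower.
Hypothesis ccw : forall i j k, (i < j)%N -> (j < k)%N ->
  0 < orient (p i) (p j) (p k).

Definition balanced_family : {fset {fset 'rV[R]_2}} :=
  [fset triangle A | A in cyclic_triples (@balanced n)].

Lemma balanced_family_spanned : family_spanned_by P balanced_family.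
Proof.
move=> T /imfsetP[A /= + ->]; rewrite inE => /andP[/eqP A3 _].
by split; [exact: triangle_sub|rewrite card_triangle].
Qed.

Lemma card_balanced_family : (1 < n)%N ->
  #|` balanced_family| = max_intersecting n.
Proof.
move=> n1; rewrite -card_cyclic_balanced//.
by rewrite card_imfset /= ?cardE//; exact: triangle_inj.
Qed.

(** The order a < c < b < d makes the edges cross properly; the third vertices of the two triangles
    complete the data for [crossing_interiors]. *)
Lemma crossing_triangles A B a b c d : #|A| = 3%N -> #|B| = 3%N ->
  a \in A -> b \in A -> c \in B -> d \in B ->
  (a < c < b)%N -> (b < d)%N -> intersecting (triangle A) (triangle B).
Proof.
have third (C : {set _}) i j : #|C| = 3%N -> i \in C -> j \in C -> i != j ->
    exists k, [/\ k \in C, i != k & j != k].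
  move=> C3 iC jC ij.
  have : (0 < #|C :\ i :\ j|)%N.
    move: C3; rewrite (cardsD1 i) iC (cardsD1 j) !inE jC eq_sym ij.
    by case: #|_|.
  by case/card_gt0P => k; rewrite !inE eq_sym (eq_sym k) => /and3P[*]; exists k.
move=> A3 B3 aA bA cB dB /andP[ac cb] bd.
have ab := ltn_trans ac cb; have cd := ltn_trans cb bd.
have nab : a != b by rewrite -val_eqE /= ltn_eqF.
have ncd : c != d by rewrite -val_eqE /= ltn_eqF.
have [e [eA ae be]] := third A a b A3 aA bA nab.
have [f [fB cf df]] := third B c d B3 cB dB ncd.
apply: (@crossing_interiors R _ _ (p a) (p b) (p c) (p d) (p e) (p f));
  rewrite /= ?mem_triangle ?orient_p_neq0//.
- by rewrite orient_flip oppr_lt0; apply: ccw.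
- exact: ccw.
- by rewrite orient_rot; apply: ccw.
- by rewrite orient_flip oppr_lt0; apply: ccw.
Qed.

Lemma balanced_family_intersecting : intersecting_family balanced_family.
Proof.
move=> _ _ /imfsetP[A /= Ac ->] /imfsetP[B /= Bc ->] nAB.
have [A3 B3] : #|A| = 3%N /\ #|B| = 3%N.
  by move: Ac Bc; rewrite !inE => /andP[/eqP -> _] /andP[/eqP -> _].
have [i [j [k [AE ij jk [ijh jkh ikh]]]]] := cyclic_balancedP Ac.
have [i' [j' [k' [BE ij' jk' [ijh' jkh' ikh']]]]] := cyclic_balancedP Bc.
have neq : [|| val i != val i', val j != val j' | val k != val k'].
  rewrite -!negb_and; apply: contra nAB => /and3P[/eqP/val_inj ii' /eqP/val_inj jj' /eqP/val_inj kk'].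
  by rewrite AE BE ii' jj' kk'.
have nh : (n <= n./2.*2.+1)%N by lia.
have [a [b [c [d []]]]] := balanced_crossing nh ij jk (ltn_ord k) ijh jkh ikh
  ij' jk' (ltn_ord k') ijh' jkh' ikh' neq.
(* Turns the crossing numbers back into indices belonging to the two triples. *)
have ord x y z C w : C = [set x; y; z]%SET -> w \in [:: val x; val y; val z] ->
    exists2 u : 'I_n, u \in C & w = u.
  move=> -> /(@mapP _ _ (val : 'I_n -> nat) [:: x; y; z])[u + ->].
  by rewrite !inE => u3; exists u; rewrite // !inE -orbA.
move=> /(ord _ _ _ _ _ AE)[{}a aA ->] /(ord _ _ _ _ _ AE)[{}b bA ->].
move=> /(ord _ _ _ _ _ BE)[{}c cB ->] /(ord _ _ _ _ _ BE)[{}d dB ->].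
(* The second interleaving is the first with the triangles exchanged. *)
case/orP => /andP[].
  exact: crossing_triangles.
by rewrite /intersecting setIC; exact: crossing_triangles.
Qed.

End Lower.
End Families.

(** * Both bounds for a counterclockwise numbering *)

Local Open Scope fset_scope.

Theorem theorem2 (R : realType) (n : nat) (P : {fset 'rV[R]_2})
    (hn : (3 <= n)%N) (hP : #|` P| = n)
    (hconv : convex_position P) (hcol : no_three_collinear P) :
  (forall F : {fset {fset 'rV[R]_2}},
      family_spanned_by P F -> intersecting_family F ->
      (#|` F| <= max_intersecting n)%N)
  /\
  (exists F : {fset {fset 'rV[R]_2}},
      [/\ family_spanned_by P F, intersecting_family F
        & #|` F| = max_intersecting n]).
Proof.
have n1 : (1 < n)%N := ltnW hn.
have [s [s_uniq sP ccw]] := convex_ccw_enumeration hconv hcol.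
have sn : size s = n.
  by rewrite -hP; apply/eqP; rewrite -uniq_size_uniq ?fset_uniq//.
(* The default zero is never reached, since [s] has length [n]. *)
pose p (i : 'I_n) := nth (GRing.zero : 'rV[R]_2) s i.
have p_inj : injective p.
  by move=> i j /eqP; rewrite nth_uniq ?sn// => /eqP/val_inj.
have pP x : x \in P <-> exists i, x = p i.
  rewrite -sP; split=> [/(nthP (GRing.zero : 'rV[R]_2))[i]|[i ->]].
    by rewrite sn => ni <-; exists (Ordinal ni).
  by rewrite mem_nth// sn.
split=> [F F_span F_int|].
  exact: (card_intersecting_family p_inj pP hcol F_span F_int).
exists (balanced_family p); split.
- exact: balanced_family_spanned.
- apply: (balanced_family_intersecting p_inj pP hcol) => i j k ij jk.
  by apply: ccw; rewrite // sn.
- exact: card_balanced_family.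
Qed.
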